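(* The group $P$ of all orientation preserving piecewise linear homeomorphisms of the unit interval $[0,1]$ is invariably generated.
   Context: Piecewise linear homeomorphisms of $[0,1]$ have finitely many breaks, a break being a point of $(0,1)$ at which the map is not differentiable; the group operation is composition. A subgroup $H$ of a group $G$ is called classful if for every $g\in G$ some conjugate of $g$ in $G$ lies in $H$, equivalently $\bigcup_{g\in G} gHg^{-1}=G$. A group $G$ is invariably generated if it has no classful subgroup other than $G$ itself. *)

(* Defs.v *)
From HB Require Import structures.
From mathcomp Require Import all_boot all_order all_algebra.
From mathcomp Require Import all_classical all_reals all_analysis.
From mathcomp Require Import ring.

Set Implicit Arguments.
Unset Strict Implicit.
Unset Printing Implicit Defensive.

Import Order.TTheory GRing.Theory Num.Theory.
Import numFieldNormedType.Exports.

Local Open Scope classical_set_scope.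
Local Open Scope ring_scope.

Section InvariableGeneration.
Variable G : groupType.

Definition subgroup (H : set G) := group_closed (fun x => x \in H).

(* [(g ^ x)%g] is the conjugate [x^-1 * g * x]. *)
Definition classful (H : set G) :=
  subgroup H /\ forall g : G, exists x : G, H (g ^ x)%g.

Definition invariably_generated := forall H : set G, classful H -> H = setT.

End InvariableGeneration.

Lemma within_continuous_comp_in {U V W : topologicalType} (A : set U)
    (B : set V) (f : U -> V) (g : V -> W) :
  {homo f : x / A x >-> B x} ->
  {within A, continuous f} -> {within B, continuous g} ->
  {within A, continuous (g \o f)}.
Proof.
move=> AB /subspace_continuousP fc /subspace_continuousP gc.
apply/subspace_continuousP => x Ax.
apply: (@cvg_comp _ _ _ f g _ (within B (nbhs (f x)))); last exact/gc/AB.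
move=> P /= /(fc x Ax); rewrite /nbhs/= /within/=.
by apply: filterS => z zP Az; exact: zP (AB _ Az).
Qed.

Section PLHomeomorphisms.
Variable R : realType.
Implicit Types (f g : R -> R) (a b x y : R) (s S : seq R).

Local Notation I := (`[0, 1]%classic : set R).

(* Homeomorphism of [0,1] with the subspace topology; only the restriction of f
   to [0,1] matters, and g is its inverse there. *)
Definition unit_interval_homeo f := exists g,
  [/\ {within I, continuous f}, {within I, continuous g},
      {homo f : x / I x}, {homo g : x / I x} &
      {in I, cancel f g} /\ {in I, cancel g f}].

Definition affine_on a b f :=
  exists m c : R, {in `[a, b], forall x, f x = m * x + c}.

(* The finite list [s] consists of the right ends of the pieces, ending in 1. *)
Definition piecewise_linear f :=
  exists2 s, itv_partition 0 1 s &
    forall i, (i < size s)%N ->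
      affine_on (nth 0 (0 :: s) i) (nth 0 (0 :: s) i.+1) f.

(* A self-map of [0,1] is encoded as a function on R fixing every point outside
   [0,1], so that Leibniz equality of functions is equality of the maps. *)
Definition PLhomeo_spec f :=
  [/\ forall x, ~ I x -> f x = x,
      unit_interval_homeo f,
      {in I &, {homo f : x y / x < y}} &
      piecewise_linear f].

Record PLhomeo := MkPLhomeo {
  PLhomeo_fun :> R -> R;
  PLhomeoP : PLhomeo_spec PLhomeo_fun
}.

Lemma PLhomeo_eq (f g : PLhomeo) : f =1 g -> f = g.
Proof.
case: f g => [f fP] [g gP] /= /funext fg; subst g.
by congr MkPLhomeo; exact: Prop_irrelevance.
Qed.

HB.instance Definition _ := gen_eqMixin PLhomeo.
HB.instance Definition _ := gen_choiceMixin PLhomeo.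

Let inIE x : (x \in I) = (0 <= x <= 1).
Proof. by apply/idP/idP; rewrite inE /= in_itv. Qed.

Let IE x : I x <-> 0 <= x <= 1.
Proof. by rewrite /= in_itv. Qed.

Lemma affine_on_sub a b a' b' f :
  a <= a' -> b' <= b -> affine_on a b f -> affine_on a' b' f.
Proof.
move=> aa bb [m [c H]]; exists m, c => x; rewrite in_itv/= => /andP[x1 x2].
by apply: H; rewrite in_itv/= (le_trans aa)// (le_trans x2).
Qed.

Lemma affine_on_refl a f : affine_on a a f.
Proof.
exists 0, (f a) => x; rewrite in_itv/= => /andP[x1 x2].
have -> : x = a by apply/eqP; rewrite eq_le x2 x1.
by rewrite mul0r add0r.
Qed.

Definition affine_off S f := forall a b, 0 <= a -> a <= b -> b <= 1 ->
  (forall x, x \in S -> a < x -> x < b -> False) -> affine_on a b f.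

Lemma path_affine_on p s f a b : path <%R p s ->
  (forall i, (i < size s)%N ->
     affine_on (nth 0 (p :: s) i) (nth 0 (p :: s) i.+1) f) ->
  p <= a -> a < b -> b <= last p s ->
  (forall x, x \in s -> a < x -> x < b -> False) -> affine_on a b f.
Proof.
elim: s p => [|t s IH] p /=.
  by move=> _ _ pa ab bp _; have := lt_le_trans ab (le_trans bp pa); rewrite ltxx.
move=> /andP[pt ts] H pa ab bl noS.
have [bt|tb] := leP b t; first by apply: affine_on_sub pa bt (H 0%N isT).
have [ta|at_] := leP t a; last by case: (noS t _ at_ tb); rewrite inE eqxx.
apply: (IH t) => //.
- by move=> i si; apply: (H i.+1).
- by move=> x xs; apply: noS; rewrite inE xs orbT.
Qed.

Lemma piecewise_linearP f :
  piecewise_linear f <-> exists S, affine_off S f.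
Proof.
split=> [[s [ps /eqP ls] H]|[S HS]].
  exists s => a b a0 ab b1 noS; move: ab; rewrite le_eqVlt => /orP[/eqP <-|ab].
    exact: affine_on_refl.
  by apply: (path_affine_on ps H) => //; rewrite ls.
pose t : seq R := sort <=%R (undup [seq x <- S | 0 < x < 1]).
have mt x : (x \in t) = (x \in S) && (0 < x < 1).
  by rewrite mem_sort mem_undup mem_filter andbC.
have st : sorted <%R t by rewrite sort_lt_sorted undup_uniq.
pose s : seq R := rcons t 1.
have ps : path <%R 0 s.
  rewrite /s rcons_path; apply/andP; split.
    rewrite path_sortedE; last exact: lt_trans.
    by rewrite st andbT; apply/allP => x; rewrite mt => /and3P[].
  have [->|] := eqVneq (last 0 t) 0; first exact: ltr01.
  have : last 0 t \in 0 :: t by exact: mem_last.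
  by rewrite inE => /orP[->//|]; rewrite mt => /and3P[].
exists s; first by split=> //; rewrite /s last_rcons.
have sp : sorted <%R (0 :: s) by [].
have mono := sorted_ltn_nth lt_trans 0 sp.
have s1 x : x \in 0 :: s -> 0 <= x <= 1.
  rewrite inE => /orP[/eqP ->|]; first by rewrite lexx ler01.
  rewrite /s mem_rcons inE => /orP[/eqP ->|]; first by rewrite lexx ler01.
  by rewrite mt => /and3P[_ h1 h2]; rewrite !ltW.
move=> i si.
have i0 : (i < size (0%R :: s))%N by rewrite /= ltnS ltnW.
have i1 : (i.+1 < size (0%R :: s))%N by rewrite /= ltnS.
have /andP[a0 _] := s1 _ (mem_nth 0 i0).
have /andP[_ b1] := s1 _ (mem_nth 0 i1).
have ab : nth 0 (0 :: s) i < nth 0 (0 :: s) i.+1 by apply: mono; rewrite ?inE.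
apply: HS => //; first exact: ltW.
move=> x xS xa xb.
have xs : x \in 0 :: s.
  rewrite inE /s mem_rcons inE mt xS (le_lt_trans a0 xa) (lt_le_trans xb b1).
  by rewrite !orbT.
have xi := nth_index 0 xs.
have ix : (index x (0%R :: s) < size (0%R :: s))%N by rewrite index_mem.
have [ji|ij] := leqP (index x (0%R :: s)) i.
  move: ji; rewrite leq_eqVlt => /orP[/eqP ji|ji].
    by move: xa; rewrite -xi ji ltxx.
  by have := mono _ _ ix i0 ji; rewrite xi => /(lt_trans xa); rewrite ltxx.
move: ij; rewrite leq_eqVlt => /orP[/eqP ij|ij].
  by move: xb; rewrite -[X in X < _]xi -ij ltxx.
by have := mono _ _ i1 ix ij; rewrite xi => /(lt_trans xb); rewrite ltxx.
Qed.

Lemma PLhomeo_inv_ex (f : PLhomeo) :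
  exists g : PLhomeo, cancel f g /\ cancel g f.
Proof.
have [fout [g0 [fc gc fI gI [fK gK]]] fincr fpl] := PLhomeoP f.
pose g x := if x \in I then g0 x else x.
have gE : {in I, g =1 g0} by move=> x xI; rewrite /g xI.
have gin x : I x -> g x = g0 x by move=> xI; apply: gE; rewrite inE.
have gout x : ~ I x -> g x = x by move=> xI; rewrite /g memNset.
have fg : cancel f g.
  move=> x; have [xI|xI] := pselect (I x).
    by rewrite gin ?fK ?inE//; exact: fI.
  by rewrite fout// gout.
have gf : cancel g f.
  move=> x; have [xI|xI] := pselect (I x).
    by rewrite gin ?gK ?inE.
  by rewrite gout// fout.
have gI' x : I x -> I (g x) by move=> xI; rewrite gin//; exact: gI.
have gincr : {in I &, {homo g : x y / x < y}}.
  move=> x y /set_mem xI /set_mem yI xy; rewrite ltNge le_eqVlt; apply/negP.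
  move=> /orP[/eqP gxy|gxy].
    by move: xy; rewrite -(gf x) -(gf y) gxy ltxx.
  have := fincr _ _ (mem_set (gI' _ yI)) (mem_set (gI' _ xI)) gxy.
  by rewrite !gf => /(lt_trans xy); rewrite ltxx.
suff gP : PLhomeo_spec g by exists (MkPLhomeo gP).
split=> //.
  exists f; split=> //; last by split=> x _.
  by apply: (subspace_eq_continuous _ gc) => x xI; exact/esym/gE.
apply/piecewise_linearP; move/piecewise_linearP: fpl => [S HS].
exists [seq f x | x <- S] => a b a0 + b1 noS.
rewrite le_eqVlt => /orP[/eqP <-|ab]; first exact: affine_on_refl.
have aI : I a by apply/IE; rewrite a0 (le_trans (ltW ab)).
have bI : I b by apply/IE; rewrite b1 andbT (le_trans a0 (ltW ab)).
have /IE/andP[ga0 _] := gI' _ aI.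
have /IE/andP[_ gb1] := gI' _ bI.
have gab : g a < g b by apply: gincr => //; exact: mem_set.
have [|m [c mc]] := HS (g a) (g b) ga0 (ltW gab) gb1.
  move=> x xS ax xb.
  have xI : I x by apply/IE; rewrite (le_trans ga0 (ltW ax)) (le_trans (ltW xb)).
  apply: (noS (f x)); first exact: map_f.
    by rewrite -(gf a); apply: fincr => //; apply: mem_set => //; exact: gI'.
  by rewrite -(gf b); apply: fincr => //; apply: mem_set => //; exact: gI'.
have gle x y : I x -> I y -> x <= y -> g x <= g y.
  move=> xI yI; rewrite le_eqVlt => /orP[/eqP ->//|xy].
  by apply/ltW/gincr => //; exact: mem_set.
have mcg y : a <= y -> y <= b -> y = m * g y + c.
  move=> ay yb; rewrite -mc ?gf//.
  have yI : I y by apply/IE; rewrite (le_trans a0)// (le_trans yb).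
  by rewrite in_itv/= !gle.
have m0 : m != 0.
  apply/eqP => m0; have := mcg a (lexx a) (ltW ab).
  rewrite m0 mul0r => ac; have := mcg b (ltW ab) (lexx b).
  by rewrite m0 mul0r => bc; move: ab; rewrite ac bc ltxx.
exists m^-1, (- (m^-1 * c)) => y; rewrite in_itv/= => /andP[ay yb].
by rewrite {2}(mcg y ay yb) mulrDr mulKf// addrK.
Qed.

Lemma PLhomeo_spec_id : PLhomeo_spec id.
Proof.
split=> //.
  by exists id; split=> //; apply: continuous_subspaceT => x; exact: cvg_id.
exists [:: 1]; first by split=> //=; rewrite ltr01.
move=> [|//] _; exists 1, 0 => x _.
by rewrite mul1r addr0.
Qed.

Lemma PLhomeo_spec_comp (f g : PLhomeo) : PLhomeo_spec (f \o g).
Proof.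
have [fout [f' [fc f'c fI f'I [fK f'K]]] fincr fpl] := PLhomeoP f.
have [gout [g' [gc g'c gI g'I [gK g'K]]] gincr gpl] := PLhomeoP g.
split.
- by move=> x xI /=; rewrite gout// fout.
- exists (g' \o f'); split.
  + exact: (within_continuous_comp_in (B := I)).
  + exact: (within_continuous_comp_in (B := I)).
  + by move=> x xI; exact/fI/gI.
  + by move=> x xI; exact/g'I/f'I.
  + split=> x /set_mem xI /=.
      by rewrite fK ?gK//; apply: mem_set => //; exact: gI.
    by rewrite g'K ?f'K//; apply: mem_set => //; exact: f'I.
- move=> x y /set_mem xI /set_mem yI xy /=.
  by apply: fincr; rewrite ?gincr//; apply: mem_set => //; exact: gI.
move/piecewise_linearP : fpl => [S HS].
move/piecewise_linearP : gpl => [T HT].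
have [g1 [g1K gK1]] := PLhomeo_inv_ex g.
have [g1out _ g1incr _] := PLhomeoP g1.
apply/piecewise_linearP; exists (T ++ [seq g1 x | x <- S]) => a b a0 + b1 noS.
rewrite le_eqVlt => /orP[/eqP <-|ab]; first exact: affine_on_refl.
have aI : I a by apply/IE; rewrite a0 (le_trans (ltW ab)).
have bI : I b by apply/IE; rewrite b1 andbT (le_trans a0 (ltW ab)).
have /IE/andP[ga0 _] := gI _ aI.
have /IE/andP[_ gb1] := gI _ bI.
have gab : g a < g b by apply: gincr => //; exact: mem_set.
have [|m [c mc]] := HT a b a0 (ltW ab) b1.
  by move=> x xT; apply: noS; rewrite mem_cat xT.
have [|n [d nd]] := HS (g a) (g b) ga0 (ltW gab) gb1.
  move=> x xS ax xb.
  have xI : I x by apply/IE; rewrite (le_trans ga0 (ltW ax)) (le_trans (ltW xb)).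
  apply: (noS (g1 x)); first by rewrite mem_cat map_f ?orbT.
    by rewrite -(g1K a); apply: g1incr => //; apply: mem_set => //; exact: gI.
  by rewrite -(g1K b); apply: g1incr => //; apply: mem_set => //; exact: gI.
have gle x y : I x -> I y -> x <= y -> g x <= g y.
  move=> xI yI; rewrite le_eqVlt => /orP[/eqP ->//|xy].
  by apply/ltW/gincr => //; exact: mem_set.
exists (n * m), (n * c + d) => x xab; move: (xab); rewrite in_itv/= => /andP[ax xb].
have xI : I x by apply/IE; rewrite (le_trans a0)// (le_trans xb).
have gxab : g x \in `[g a, g b] by rewrite in_itv/= !gle.
by rewrite /= (nd _ gxab) (mc _ xab); ring.
Qed.

Definition PLhomeo_one := MkPLhomeo PLhomeo_spec_id.
Definition PLhomeo_mul (f g : PLhomeo) := MkPLhomeo (PLhomeo_spec_comp f g).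
Definition PLhomeo_inv (f : PLhomeo) : PLhomeo := sval (cid (PLhomeo_inv_ex f)).

Let PLhomeo_mulA : associative PLhomeo_mul.
Proof. by move=> f g h; exact: PLhomeo_eq. Qed.

Let PLhomeo_mul1 : left_id PLhomeo_one PLhomeo_mul.
Proof. by move=> f; exact: PLhomeo_eq. Qed.

Let PLhomeo_1mul : right_id PLhomeo_one PLhomeo_mul.
Proof. by move=> f; exact: PLhomeo_eq. Qed.

Let PLhomeo_mulV : left_inverse PLhomeo_one PLhomeo_inv PLhomeo_mul.
Proof.
by move=> f; apply: PLhomeo_eq => x; case: (svalP (cid (PLhomeo_inv_ex f))) => + _; apply.
Qed.

Let PLhomeo_Vmul : right_inverse PLhomeo_one PLhomeo_inv PLhomeo_mul.
Proof.
by move=> f; apply: PLhomeo_eq => x; case: (svalP (cid (PLhomeo_inv_ex f))) => _ +; apply.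
Qed.

HB.instance Definition _ := isGroup.Build PLhomeo
  PLhomeo_mulA PLhomeo_mul1 PLhomeo_1mul PLhomeo_mulV PLhomeo_Vmul.

Lemma PLhomeo1E x : (1%g : PLhomeo) x = x.
Proof. by []. Qed.

Lemma PLhomeoME (f g : PLhomeo) x : (f * g)%g x = f (g x).
Proof. by []. Qed.

End PLHomeomorphisms.

(* Main.v *)
Require Import Defs.
From mathcomp Require Import all_boot all_order all_algebra.
From mathcomp Require Import all_classical all_reals all_analysis.
From mathcomp Require Import lra ring.

Set Implicit Arguments.
Unset Strict Implicit.
Unset Printing Implicit Defensive.

Import Order.TTheory GRing.Theory Num.Theory.
Import numFieldNormedType.Exports.

Local Open Scope classical_set_scope.
Local Open Scope ring_scope.

(** Let [H] be classful. Conjugation preserves one-sided slopes, so [H] contains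
    elements with every right germ "identity up to [c], slope [a] after [c]",
    first at some [c], then at every [c] once [H] is known to be transitive on
    (0, 1). The key step is to make the intervals of validity of these germs
    uniform: if [g] in [H] is affine of slope [> 1] on [c, d], fixes everything up
    to [c] and moves every point of (c, 1) to the right, then conjugating a germ at
    [c] by a large power of [g] gives an element of [H] that is affine on the whole
    of [c, d]. Taking [c = 0] gives uniform dilations at 0, and these carry the
    uniform germs at one [c > 0] to all base points of [c, d]. Composing finitely
    many of them, every piecewise linear map supported right of [c] agrees with an
    element of [H] as long as its argument and value stay below [d]; contracting towards [c] inside [H], every element of
    the group agrees with an element of [H] on [0, b], for any [b < 1].

    If [u] is the identity on [b, 1] and [y u y^-1] is in [H], then [y] may be
    replaced by an element of [H] agreeing with it on [0, b], so [u] is in [H].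
    Finally [x (y x y^-1)^-1] has slope 1 at 1, which gives [x] in [H]. *)

(** * Order, slopes and a model expanding map *)

Section PLBasics.
Variable R : realType.
Implicit Types (f g h x y : PLhomeo R) (a b c d e m s t : R).

Lemma PLhomeoK f : cancel f (f^-1)%g.
Proof. by move=> t; rewrite -PLhomeoME mulVg. Qed.

Lemma PLhomeoVK f : cancel (f^-1)%g f.
Proof. by move=> t; rewrite -PLhomeoME mulgV. Qed.

Lemma PLhomeo_out f t : ~~ (0 <= t <= 1) -> f t = t.
Proof.
move=> tI; have [fout _ _ _] := PLhomeoP f; apply: fout.
by rewrite /= in_itv; exact/negP.
Qed.

Lemma PLhomeo_itv f t : 0 <= t <= 1 -> 0 <= f t <= 1.
Proof.
have [_ [g [_ _ fI _ _]] _ _] := PLhomeoP f.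
by have := fI t; rewrite /= !in_itv/=.
Qed.

(** Since maps are extended by the identity outside [0, 1], monotonicity holds on the whole line
    without side conditions. *)
Lemma PLhomeo_lt f : {mono f : s t / s < t}.
Proof.
apply: leW_mono; apply: le_mono => s t st.
have [_ _ fincr _] := PLhomeoP f.
have [sI|sI] := boolP (0 <= s <= 1); have [tI|tI] := boolP (0 <= t <= 1).
- by apply: fincr => //; rewrite inE /= in_itv.
- by rewrite (PLhomeo_out f tI); have := PLhomeo_itv f sI; lra.
- by rewrite (PLhomeo_out f sI); have := PLhomeo_itv f tI; lra.
- by rewrite !PLhomeo_out.
Qed.

Lemma PLhomeo_le f : {mono f : s t / s <= t}.
Proof. by move=> s t; rewrite !leNgt PLhomeo_lt. Qed.

Lemma PLhomeo0 f : f 0 = 0.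
Proof.
apply/le_anti/andP; split; last by have := PLhomeo_itv f (t := 0); lra.
by rewrite -(PLhomeo_le f^-1%g) PLhomeoK; have := PLhomeo_itv (f^-1)%g (t := 0); lra.
Qed.

Lemma PLhomeo1 f : f 1 = 1.
Proof.
apply/le_anti/andP; split; first by have := PLhomeo_itv f (t := 1); lra.
by rewrite -(PLhomeo_le f^-1%g) PLhomeoK; have := PLhomeo_itv (f^-1)%g (t := 1); lra.
Qed.

Lemma PLhomeo_gt0 f t : (0 < f t) = (0 < t).
Proof. by rewrite -{1}(PLhomeo0 f) PLhomeo_lt. Qed.

Lemma PLhomeo_lt1 f t : (f t < 1) = (t < 1).
Proof. by rewrite -{1}(PLhomeo1 f) PLhomeo_lt. Qed.

Definition affine_slope a b m (h : R -> R) :=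
  forall t, a <= t -> t <= b -> h t = h a + m * (t - a).

Lemma affine_on_slope a b h : a < b -> affine_on a b h ->
  exists2 m, 0 < m & affine_slope a b m h.
Proof.
move=> ab [m [c mc]].
have hE t : a <= t -> t <= b -> h t = m * t + c.
  by move=> ta tb; apply: mc; rewrite in_itv/= ta.
exists m; last by move=> t ta tb; rewrite !hE ?(ltW ab)//; ring.
have : h a < h b by rewrite PLhomeo_lt.
rewrite !hE ?(ltW ab)// => H.
have : 0 < m * (b - a) by lra.
by rewrite pmulr_lgt0// subr_gt0.
Qed.

Lemma affine_right f c : 0 <= c < 1 ->
  exists e, [/\ c < e, e <= 1 & exists2 m, 0 < m & affine_slope c e m f].
Proof.
move=> /andP[c0 c1]; have [_ _ _ /piecewise_linearP[S HS]] := PLhomeoP f.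
suff [e [ce e1 noS]] : exists e, [/\ c < e, e <= 1 &
    forall t, t \in S -> c < t -> t < e -> False].
  by exists e; split=> //; apply: affine_on_slope => //; apply: HS => //; exact: ltW.
elim: S {HS} => [|s S [e [ce e1 noS]]]; first by exists 1.
have [cs|sc] := ltP c s; last first.
  exists e; split=> // t; rewrite inE => /predU1P[->|]; last exact: noS.
  by rewrite ltNge sc.
exists (Num.min s e); split; [by rewrite lt_min cs ce|by rewrite ge_min e1 orbT|].
move=> t; rewrite inE lt_min => /predU1P[->|tS] ct /andP[ts te]; last exact: (noS t).
by rewrite ltxx in ts.
Qed.

Lemma affine_left1 f :
  exists e, [/\ 0 <= e, e < 1 & exists2 m, 0 < m & affine_slope e 1 m f].
Proof.
have [_ _ _ /piecewise_linearP[S HS]] := PLhomeoP f.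
suff [e [ce e1 noS]] : exists e, [/\ 0 <= e, e < 1 &
    forall t, t \in S -> e < t -> t < 1 -> False].
  by exists e; split=> //; apply: affine_on_slope => //; apply: HS => //; exact: ltW.
elim: S {HS} => [|s S [e [ce e1 noS]]]; first by exists 0.
have [cs|sc] := ltP s 1; last first.
  exists e; split=> // t; rewrite inE => /predU1P[->|]; last exact: noS.
  by move=> _ /lt_geF; rewrite sc.
exists (Num.max s e); split; [by rewrite le_max ce orbT|by rewrite gt_max cs e1|].
move=> t; rewrite inE gt_max => /predU1P[->|tS] /andP[ts te] ct; last exact: (noS t).
by rewrite ltxx in ts.
Qed.

(** The graph follows the diagonal up to [c], then the line of slope [a] through (c, c), then the
    line of slope [b = a^-1] through (1, 1); both lines lie above the diagonal over (c, 1). *)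
Lemma exists_bump c a : 0 <= c < 1 -> 1 < a -> exists f : PLhomeo R,
  [/\ forall t, t <= c -> f t = t,
      exists2 e, c < e & forall t, c <= t -> t <= e -> f t = c + a * (t - c) &
      forall t, c < t -> t < 1 -> t < f t].
Proof.
move=> c01 a1; have a0 : 0 < a by lra.
have [b aV] : exists b, a * b = 1 by exists a^-1; rewrite mulfV// gt_eqF.
have b0 : 0 < b by rewrite -(pmulr_rgt0 _ a0) aV.
have b1 : b < 1 by rewrite -(ltr_pM2l a0) aV mulr1.
have ab0 : 0 < a - b by lra.
pose bump t := Num.max t (Num.min (c + a * (t - c)) (1 - b * (1 - t))).
pose bumpV s := Num.min s (Num.max (c + b * (s - c)) (1 - a * (1 - s))).
have [p [cp p_le p_ge]] : exists p, [/\ c < p,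
    forall t, (t <= p) = (c + a * (t - c) <= 1 - b * (1 - t)) &
    forall t, p <= t -> 1 - b * (1 - t) <= c + a * (t - c)].
  (* The abscissa where the two lines cross. *)
  exists ((1 - b - c + a * c) / (a - b)); split.
  - by rewrite ltr_pdivlMr//; nra.
  - by move=> t; rewrite ler_pdivlMr//; apply/idP/idP; lra.
  - by move=> t; rewrite ler_pdivrMr//; lra.
(* [bump] and [bumpV] form a Galois connection for both [<=] and [<], hence are
   inverse to each other. *)
have bump_le s t : (bump t <= s) = (t <= bumpV s).
  rewrite /bump /bumpV ge_max ge_min le_min le_max; congr (_ && (_ || _)).
    by rewrite -(ler_pM2l a0 t) [a * (c + _)]mulrDr [a * (b * _)]mulrA aV mul1r;
      apply/idP/idP; lra.
  by rewrite -(ler_pM2l a0 _ s) [a * (1 - _)]mulrBr [a * (b * _)]mulrA aV mul1r;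
    apply/idP/idP; lra.
have bump_lt s t : (bump t < s) = (t < bumpV s).
  rewrite /bump /bumpV gt_max gt_min lt_min lt_max; congr (_ && (_ || _)).
    by rewrite -(ltr_pM2l a0 t) [a * (c + _)]mulrDr [a * (b * _)]mulrA aV mul1r;
      apply/idP/idP; lra.
  by rewrite -(ltr_pM2l a0 _ s) [a * (1 - _)]mulrBr [a * (b * _)]mulrA aV mul1r;
    apply/idP/idP; lra.
have bumpK : cancel bump bumpV.
  by move=> t; apply/eqP; rewrite eq_le -bump_le lexx andbT leNgt -bump_lt ltxx.
have bumpVK : cancel bumpV bump.
  by move=> t; apply/eqP; rewrite eq_le bump_le lexx leNgt bump_lt ltxx.
have affineC (u v w : R) : continuous (fun t : R => u + v * (t - w)).
  move=> t; apply: cvgD; first exact: cvg_cst.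
  by apply: cvgM; [exact: cvg_cst|apply: cvgB; [exact: cvg_id|exact: cvg_cst]].
have affineC' (u v w : R) : continuous (fun t : R => u - v * (w - t)).
  move=> t; apply: cvgB; first exact: cvg_cst.
  by apply: cvgM; [exact: cvg_cst|apply: cvgB; [exact: cvg_cst|exact: cvg_id]].
have bump1 t : t <= c -> bump t = t.
  by move=> tc; apply/max_idPl; rewrite ge_min; apply/orP; left; nra.
have bump2 t : c <= t -> t <= p -> bump t = c + a * (t - c).
  by move=> ct; rewrite p_le => tp; rewrite /bump (min_idPl tp); apply/max_idPr; nra.
have bump3 t : p <= t -> t <= 1 -> bump t = 1 - b * (1 - t).
  by move=> pt t1; rewrite /bump (min_idPr (p_ge _ pt)); apply/max_idPr; nra.
have bumpP : PLhomeo_spec bump.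
  split.
  - move=> t; rewrite /= in_itv/= => tI; apply/max_idPl; rewrite ge_min.
    have [t0|t0] := ltP t 0; apply/orP; [left; nra|right].
    have t1 : 1 < t by rewrite ltNge; apply/negP => t1; apply: tI; rewrite t0.
    nra.
  - exists bumpV; split.
    + apply: continuous_subspaceT => t.
      apply: (@continuous_max R R (fun t => t) (fun t => Num.min _ _)).
        exact: cvg_id.
      apply: (@continuous_min R R (fun t => _ + _ * (t - _))
        (fun t => _ - _ * (_ - t))).
        exact: affineC.
      exact: affineC'.
    + apply: continuous_subspaceT => t.
      apply: (@continuous_min R R (fun t => t) (fun t => Num.max _ _)).
        exact: cvg_id.
      apply: (@continuous_max R R (fun t => _ + _ * (t - _))
        (fun t => _ - _ * (_ - t))).
        exact: affineC.
      exact: affineC'.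
    + move=> t; rewrite /= !in_itv/= => /andP[t0 t1].
      by rewrite le_max t0/= ge_max t1 ge_min; apply/orP; right; nra.
    + move=> t; rewrite /= !in_itv/= => /andP[t0 t1].
      by rewrite le_min t0/= ge_min t1 le_max andbT; apply/orP; left; nra.
    + by split=> t _; rewrite ?bumpK ?bumpVK.
  - by move=> s t _ _ st; rewrite bump_lt bumpK.
  apply/piecewise_linearP; exists [:: c; p] => s t s0 st t1 noS.
  have [sc|cs] := ltP s c.
    have tc : t <= c.
      by rewrite leNgt; apply/negP => ct; apply: (noS c) => //; rewrite inE eqxx.
    exists 1, 0 => u; rewrite in_itv/= => /andP[su ut].
    by rewrite bump1 ?(le_trans ut)//; ring.
  have [sp|ps] := ltP s p.
    have tp : t <= p.
      by rewrite leNgt; apply/negP => ct; apply: (noS p) => //; rewrite !inE eqxx orbT.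
    exists a, (c - a * c) => u; rewrite in_itv/= => /andP[su ut].
    by rewrite bump2 ?(le_trans ut) ?(le_trans cs)//; ring.
  exists b, (1 - b) => u; rewrite in_itv/= => /andP[su ut].
  by rewrite bump3 ?(le_trans ut) ?(le_trans ps)//; ring.
exists (MkPLhomeo bumpP); split=> /=; [exact: bump1|by exists p|].
move=> t ct t1; rewrite /bump lt_max lt_min; apply/orP; right.
by apply/andP; split; nra.
Qed.

End PLBasics.

(** * Dilation germs and their linearization *)

Section Dilations.
Variable R : realType.
Implicit Types (f g h x y : PLhomeo R) (a b c d e m s t : R).

(* The last premise keeps the image in the interval, so that dilations of ratio
   less than 1 and greater than 1 are treated alike. *)
Definition dilation c d a (h : R -> R) :=
  (forall t, t <= c -> h t = t) /\
  forall t, c <= t -> t <= d -> c + a * (t - c) <= d -> h t = c + a * (t - c).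

Definition right_germ c a (h : R -> R) := exists2 e, c < e & dilation c e a h.

Definition expands_above c (h : R -> R) :=
  (forall t, t <= c -> h t = t) /\ forall t, c < t -> t < 1 -> t < h t.

Lemma dilation_sub c d d' a (h : R -> R) :
  d' <= d -> dilation c d a h -> dilation c d' a h.
Proof. by move=> dd [h1 h2]; split=> // t ct td v; apply: h2; lra. Qed.

Lemma dilation1 c d : dilation c d 1 (1%g : PLhomeo R).
Proof. by split=> // t _ _ _; rewrite PLhomeo1E; ring. Qed.

(** Because [1 <= a], the intermediate value is at most the final one, so it stays below [d]. *)
Lemma dilationM c d a b f g : 1 <= a -> 0 <= b ->
  dilation c d a f -> dilation c d b g -> dilation c d (a * b) (f * g)%g.
Proof.
move=> a1 b0 [f1 f2] [g1 g2]; split=> t.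
  by move=> tc; rewrite PLhomeoME g1// f1.
move=> ct td v; have bt : 0 <= b * (t - c) by rewrite mulr_ge0// subr_ge0.
have bat : b * (t - c) <= a * b * (t - c) by rewrite -mulrA ler_peMl.
rewrite PLhomeoME g2//; last lra.
by rewrite f2; lra.
Qed.

Lemma dilationX c d a f n : 1 <= a ->
  dilation c d a f -> dilation c d (a ^+ n) (f ^+ n)%g.
Proof.
move=> a1 fa; elim: n => [|n IH]; first exact: dilation1.
by rewrite expgS exprS; apply: dilationM => //; apply: exprn_ge0; lra.
Qed.

Lemma dilationV c d a f : 0 < a ->
  dilation c d a f -> dilation c d a^-1 (f^-1)%g.
Proof.
move=> a0 [f1 f2]; split=> t.
  by move=> tc; rewrite -{1}(f1 t tc) PLhomeoK.
move=> ct td; set s := c + _ => sd.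
have cs : c <= s by rewrite /s lerDl mulr_ge0 ?invr_ge0 ?subr_ge0// ltW.
have st : c + a * (s - c) = t.
  by rewrite /s addrAC subrr add0r mulVKf ?gt_eqF// addrC subrK.
by rewrite -{1}st -f2 ?st// PLhomeoK.
Qed.

Lemma right_germV c a f : 0 < a -> right_germ c a f -> right_germ c a^-1 (f^-1)%g.
Proof. by move=> a0 [e ce fe]; exists e => //; exact: dilationV. Qed.

(** Just right of [c] the map [y] is affine, and its slope cancels in the conjugate. *)
Lemma right_germJ c a f y : 0 <= c < 1 ->
  right_germ c a f -> right_germ (y c) a (y * f * y^-1)%g.
Proof.
move=> c01 [e ce [f1 f2]]; have [e1 [ce1 _ [m m0 ym]]] := affine_right y c01.
pose u := Num.min e e1.
have ue : u <= e by rewrite ge_min lexx.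
have ue1 : u <= e1 by rewrite ge_min lexx orbT.
have cu : c < u by rewrite lt_min ce.
exists (y u); first by rewrite PLhomeo_lt.
have yfE s : (y * f * y^-1)%g (y s) = y (f s) by rewrite !PLhomeoME PLhomeoK.
split=> t; rewrite -(PLhomeoVK y t) yfE; move: (_ t) => s.
  by rewrite PLhomeo_le => sc; rewrite f1.
rewrite !PLhomeo_le => cs su.
rewrite (ym s)//; last exact: le_trans ue1.
rewrite (ym u)//; last exact: ltW.
have -> : y c + a * (y c + m * (s - c) - y c) = y c + m * (a * (s - c)) by ring.
rewrite lerD2l ler_pM2l// lerBrDl => v.
rewrite f2//; [|exact: le_trans ue|exact: le_trans ue].
(* A negative product is impossible: [f] would send [s >= c] below its fixed point [c]. *)
case: (leP 0 (a * (s - c))) => [as0|as0].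
  rewrite ym; [by rewrite [c + _]addrC addrK| by rewrite lerDl|exact: le_trans ue1].
have := PLhomeo_lt f s c.
rewrite (f1 c)// f2//; [|exact: le_trans ue|exact: le_trans ue].
by move: as0; rewrite -{1}(ltrD2l c) addr0 => -> /esym; rewrite ltNge cs.
Qed.

Lemma expands_aboveJ c f y :
  expands_above c f -> expands_above (y c) (y * f * y^-1)%g.
Proof.
have yfE s : (y * f * y^-1)%g (y s) = y (f s) by rewrite !PLhomeoME PLhomeoK.
move=> [f1 f2]; split=> t; rewrite -(PLhomeoVK y t) yfE; move: (_ t) => s.
  by rewrite PLhomeo_le => sc; rewrite f1.
by rewrite !PLhomeo_lt PLhomeo_lt1 => cs s1; exact: f2.
Qed.

(** Otherwise the infimum of the backward orbit of [p] lies in (c, 1) and [f] moves it to the right;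
    an orbit point below [f (inf A)] then has its successor below the infimum. *)
Lemma expands_above_contract c f p e : expands_above c f -> p < 1 -> c < e ->
  exists n, ((f ^+ n)^-1)%g p < e.
Proof.
move=> [f1 f2] p1 ce; apply: contrapT => /forallNP H.
have {}H n : e <= ((f ^+ n)^-1)%g p by rewrite leNgt; apply/negP/H.
pose A := [set ((f ^+ n)^-1)%g p | n in [set: nat]].
have A0 : A !=set0 by exists p, 0%N => //; rewrite expg0 invg1.
have eA : e <= inf A by apply: lb_le_inf => // _ [n _ <-].
have infA n : inf A <= ((f ^+ n)^-1)%g p.
  by apply: ge_inf; [exists e => _ [k _ <-]|exists n].
have iA1 : inf A < 1 by have := infA 0%N; rewrite expg0 invg1 PLhomeo1E; lra.
have [_ [n _ <-]] := inf_lt A0 (f2 _ (lt_le_trans ce eA) iA1).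
rewrite ltNge -[X in _ <= X](PLhomeoVK f) PLhomeo_le.
by have := infA n.+1; rewrite expgSr invgM PLhomeoME => ->.
Qed.

(* Conjugating by a large power of [g] magnifies a neighbourhood of [c] on which
   [h] is a dilation up to the whole of [c, d]. *)
Lemma dilation_linearize c d e a b g h :
  0 < a -> 1 < b -> c < d -> d < 1 -> c < e ->
  dilation c d b g -> expands_above c g -> dilation c e a h ->
  exists n, dilation c d a (g ^+ n * h * (g ^+ n)^-1)%g.
Proof.
move=> a0 b1 cd d1 ce gd gx [h1 h2].
have [n gne] := expands_above_contract gx d1 ce; exists n.
have [k1 k2] := dilationX n (ltW b1) gd.
have bn1 : 1 <= b ^+ n by rewrite exprn_ege1// ltW.
have bn0 : 0 < b ^+ n by lra.
have [l1 l2] := dilationV bn0 (dilationX n (ltW b1) gd).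
set w := b ^+ n in k2 bn1 bn0 l2; pose v := w^-1.
have wv : w * v = 1 by rewrite mulfV// gt_eqF.
have v0 : 0 < v by rewrite invr_gt0.
have v1 : v <= 1 by rewrite invf_le1.
rewrite -/v in l2.
(* The inverse of [g ^+ n] scales [c, d] by [v] into [c, e), where [h] scales by [a]; the factor [w]
   of [g ^+ n] then cancels [v]. *)
have vde : c + v * (d - c) < e by rewrite -l2//; [exact: ltW|nra].
split=> t; rewrite !PLhomeoME.
  by move=> tc; rewrite l1// h1// k1.
move=> ct td vd; have vt : 0 <= v * (t - c) <= v * (d - c) by nra.
have vdc : v * (d - c) <= d - c by nra.
have avt : 0 <= a * (v * (t - c)) <= v * (d - c) by nra.
have subE (u : R) : c + u - c = u by ring.
rewrite l2//; last lra.
rewrite h2 ?subE//; [|lra|lra|lra].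
rewrite k2 ?subE; [|lra|lra|].
  by rewrite mulrCA (mulrA w) wv mul1r.
by rewrite mulrCA (mulrA w) wv mul1r.
Qed.

Lemma exists_expanding_germ c a : 0 <= c < 1 -> 1 < a ->
  exists f, right_germ c a f /\ expands_above c f.
Proof.
move=> c01 a1; have [f [f1 [e ce fe] f2]] := exists_bump c01 a1.
by exists f; split=> //; exists e => //; split=> // t ct te _; exact: fe.
Qed.

Lemma exists_right_germ c a : 0 <= c < 1 -> 0 < a -> exists f, right_germ c a f.
Proof.
move=> c01 a0; have [a1|a1|->] := ltgtP a 1; last 1 first.
- by exists 1%g, 1; [case/andP: c01|exact: dilation1].
- have [|f [fg _]] := @exists_expanding_germ c a^-1 c01; first by rewrite invf_gt1.
  by exists (f^-1)%g; rewrite -[a]invrK; apply: right_germV => //; rewrite invr_gt0.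
- by have [f [fg _]] := exists_expanding_germ c01 a1; exists f.
Qed.

End Dilations.

(** * Decompositions into affine pieces *)

Section Pieces.
Variable R : realType.
Implicit Types (f g h x y : PLhomeo R) (a b c d e k m s t : R).

Lemma affine_slope_sub a b a' b' m (f : R -> R) :
  a <= a' -> b' <= b -> affine_slope a b m f -> affine_slope a' b' m f.
Proof.
move=> aa bb fm t at_ tb; have ab : a' <= b' by exact: le_trans tb.
by rewrite (fm t) ?(fm a'); [ring|lra..].
Qed.

Lemma affine_slopeM a b k m f g : affine_slope a b m g ->
  affine_slope (g a) (g b) k f -> affine_slope a b (k * m) (f * g)%g.
Proof.
move=> gm fk t at_ tb; rewrite !PLhomeoME fk ?PLhomeo_le//.
by rewrite (gm t)//; ring.
Qed.

Lemma affine_slopeV a b m f : 0 < m -> affine_slope a b m f ->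
  affine_slope (f a) (f b) m^-1 (f^-1)%g.
Proof.
move=> m0 fm t; rewrite -(PLhomeoVK f t) !PLhomeo_le !PLhomeoK => at_ tb.
by rewrite fm// addrAC subrr add0r mulKf ?gt_eqF// addrC subrK.
Qed.

(** Pieces may be degenerate, and composing with a map affine over the whole interval keeps [n];
    this makes [n] the induction measure of [realize_pieces]. *)
Fixpoint affine_pieces n a b (h : R -> R) : Prop :=
  if n is n'.+1 then exists p m,
    [/\ a <= p <= b, 0 < m, affine_slope a p m h & affine_pieces n' p b h]
  else a = b.

Lemma affine_pieces_le n a b (h : R -> R) : affine_pieces n a b h -> a <= b.
Proof. by case: n => [/= ->//|n] [p [m [/andP[ap pb] _ _ _]]]; exact: le_trans pb. Qed.

Lemma affine_pieces_cat n n' a b c (h : R -> R) :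
  affine_pieces n a b h -> affine_pieces n' b c h ->
  affine_pieces (n + n') a c h.
Proof.
elim: n a => [a /= ->//|n IH a] [p [m [/andP[ap pb] m0 hm H]]] H'.
exists p, m; split=> //; last exact: IH.
by rewrite ap (le_trans pb)// (affine_pieces_le H').
Qed.

Lemma affine_piecesMl n a b m f g : 0 < m -> affine_slope (g a) (g b) m f ->
  affine_pieces n a b g -> affine_pieces n a b (f * g)%g.
Proof.
move=> m0; elim: n a => [//|n IH] a fm [p [k [/andP[ap pb] k0 gk H]]].
exists p, (m * k); split; [by rewrite ap|exact: mulr_gt0| |].
  by apply: affine_slopeM => //; apply: affine_slope_sub fm => //; rewrite PLhomeo_le.
by apply: IH => //; apply: affine_slope_sub fm => //; rewrite PLhomeo_le.
Qed.

Lemma affine_piecesMr n a b m f g : 0 < m -> affine_slope a b m g ->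
  affine_pieces n (g a) (g b) f -> affine_pieces n a b (f * g)%g.
Proof.
move=> m0; elim: n a => [|n IH] a gm.
  by move=> /= /(congr1 (g^-1)%g); rewrite !PLhomeoK.
move=> [p]; rewrite -(PLhomeoVK g p); move: (_ p) => {}p [k [+ k0 fk H]].
rewrite !PLhomeo_le => /andP[ap pb].
exists p, (k * m); split; [by rewrite ap|exact: mulr_gt0| |].
  by apply: affine_slopeM => //; apply: affine_slope_sub gm.
by apply: IH => //; apply: affine_slope_sub gm.
Qed.

(** Induction on the list of possible breaks: a break inside (a, b) cuts the interval in two, any
    other is dropped. *)
Lemma PLhomeo_affine_pieces f a b : 0 <= a -> a <= b -> b <= 1 ->
  exists n, affine_pieces n a b f.
Proof.
move=> a0 ab b1; have [_ _ _ /piecewise_linearP[S HS]] := PLhomeoP f.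
(* Restricted to subintervals of [a, b], the hypothesis passes to each half. *)
have {HS} : forall a' b', a <= a' -> a' <= b' -> b' <= b ->
    (forall t, t \in S -> a' < t -> t < b' -> False) -> affine_on a' b' f.
  by move=> a' b' *; apply: HS => //; lra.
elim: S a b ab {a0 b1} => [|s S IH] a b ab HS.
  move: ab; rewrite le_eqVlt => /predU1P[<-|ab]; first by exists 0%N.
  have [m m0 fm] := affine_on_slope ab
    (HS _ _ (lexx _) (ltW ab) (lexx _) (fun _ => ltac:(by []))).
  by exists 1%N, b, m; split=> //; rewrite (ltW ab) /=.
have [as_|sa] := ltP a s; last first.
  apply: IH => // a' b' aa ab' bb noS; apply: HS => // t.
  rewrite inE => /predU1P[->|/noS//].
  by move=> /lt_geF; rewrite (le_trans sa aa).
have [sb|bs] := ltP s b; last first.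
  apply: IH => // a' b' aa ab' bb noS; apply: HS => // t.
  rewrite inE => /predU1P[->|/noS//].
  by move=> _ /lt_geF; rewrite (le_trans bb bs).
have [n Hn] : exists n, affine_pieces n a s f.
  apply: IH; [exact: ltW|move=> a' b' aa ab' bb noS; apply: HS => //; first by lra].
  by move=> t; rewrite inE => /predU1P[->|/noS//] _ /lt_geF; rewrite bb.
have [n' Hn'] : exists n, affine_pieces n s b f.
  apply: IH; [exact: ltW|move=> a' b' aa ab' bb noS; apply: HS => //; first by lra].
  by move=> t; rewrite inE => /predU1P[->|/noS//] /lt_geF; rewrite aa.
by exists (n + n')%N; exact: affine_pieces_cat Hn Hn'.
Qed.

End Pieces.

(** * Building a map out of dilations in a subgroup *)

Section Realization.
Variables (R : realType) (H : set (PLhomeo R)).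
Hypothesis subH : subgroup H.
Implicit Types (f g h x y : PLhomeo R) (a b c d e k m s t : R).

Lemma subgroup1 : H 1%g.
Proof. by case: subH => /set_mem. Qed.

Lemma subgroupM f g : H f -> H g -> H (f * g)%g.
Proof.
by move=> /mem_set Hf /mem_set Hg; apply: set_mem; exact: group_closedM subH _ _ Hf Hg.
Qed.

Lemma subgroupV f : H f -> H (f^-1)%g.
Proof. by move=> /mem_set Hf; apply: set_mem; exact: group_closedV subH _ Hf. Qed.

Lemma subgroupJ f g : H g -> H f -> H (g * f * g^-1)%g.
Proof. by move=> Hg Hf; apply: subgroupM; [exact: subgroupM|exact: subgroupV]. Qed.

Lemma subgroupX f n : H f -> H (f ^+ n)%g.
Proof.
move=> Hf; elim: n => [|n IH]; first exact: subgroup1.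
by rewrite expgS; exact: subgroupM.
Qed.

(* A first piece of slope at most 1 is removed on the right and one of slope
   greater than 1 on the left, so that all intermediate values stay below [d]. *)
Lemma realize_pieces c d :
  (forall c' a, c <= c' -> c' <= d -> 0 < a -> exists2 h, H h & dilation c' d a h) ->
  forall n x a e, c <= a -> e <= d -> x e <= d -> (forall t, t <= a -> x t = t) ->
    affine_pieces n a e x -> exists2 h, H h & forall t, t <= e -> h t = x t.
Proof.
move=> dilH; elim=> [|n IH] x a e ca ed xed x1.
  move=> /= <-; exists 1%g; first exact: subgroup1.
  by move=> t ta; rewrite x1.
move=> [p [m [/andP[ap pe] m0 xm xn]]]; move: ap; rewrite le_eqVlt => /predU1P[ap|ap].
  by apply: (IH x p) => //; rewrite -ap.
have xa : x a = a by exact: x1.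
have ad : a <= d by lra.
have [h Hh [h1 h2]] := dilH _ _ ca ad m0.
have [m1|m1] := leP m 1.
  have hE t : a <= t -> t <= e -> h t = a + m * (t - a).
    by move=> at_ te; rewrite h2//; nra.
  have hm : affine_slope a e m h by move=> t at_ te; rewrite hE// (h1 a).
  have ha : h a = a by exact: h1.
  have hp : a < h p by rewrite -{1}ha PLhomeo_lt.
  (* [x * h^-1] is the identity up to [h p] and has its remaining pieces on [h p, h e], where
     [h e <= e] since [m <= 1]. *)
  have [] // := IH (x * h^-1)%g (h p) (h e); first exact: (ltW (le_lt_trans ca hp)).
  - by rewrite hE//; nra.
  - by rewrite PLhomeoME PLhomeoK.
  - move=> t; rewrite -(PLhomeoVK h t) PLhomeo_le PLhomeoME PLhomeoK.
    move: (_ t) => s sp.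
    have [sa|as_] := leP s a; first by rewrite x1// h1.
    by rewrite xm ?(ltW as_)// hE ?xa// ?(ltW as_)// (le_trans sp).
  - apply: (affine_piecesMr (m := m^-1)); rewrite ?invr_gt0// ?PLhomeoK//.
    apply: affine_slopeV => //; apply: affine_slope_sub hm => //; exact: ltW.
  move=> k Hk kx; exists (k * h)%g; first exact: subgroupM.
  by move=> t te; rewrite PLhomeoME kx ?PLhomeo_le// PLhomeoME PLhomeoK.
have [l1 l2] := dilationV m0 (conj h1 h2).
have mV0 : 0 < m^-1 by rewrite invr_gt0.
have mV1 : m^-1 < 1 by rewrite invf_lt1.
have hVE v : a <= v -> v <= d -> (h^-1)%g v = a + m^-1 * (v - a).
  by move=> av vd; rewrite l2//; nra.
have hVm b : b <= d -> affine_slope a b m^-1 (h^-1)%g.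
  by move=> bd t at_ te; rewrite hVE ?(l1 a)//; lra.
have xp : a < x p by rewrite -{1}xa PLhomeo_lt.
have xpe : x p <= x e by rewrite PLhomeo_le.
(* [h^-1 * x] is the identity up to [p], and its value at [e] is at most [x e] since [m^-1 < 1]. *)
have [] // := IH (h^-1 * x)%g p e.
- by lra.
- by rewrite PLhomeoME hVE; nra.
- move=> t tp; rewrite PLhomeoME.
  have [ta|at_] := leP t a; first by rewrite x1// l1.
  have xt : a < x t by rewrite -{1}xa PLhomeo_lt.
  have xtp : x t <= x p by rewrite PLhomeo_le.
  rewrite hVE; [|lra..].
  by rewrite xm ?(ltW at_)// xa addrAC subrr add0r mulKf ?gt_eqF// addrC subrK.
- apply: (affine_piecesMl mV0) => //.
  by apply: affine_slope_sub (hVm _ xed) => //; exact: ltW.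
move=> k Hk kx; exists (h * k)%g; first exact: subgroupM.
by move=> t te; rewrite PLhomeoME kx// PLhomeoME PLhomeoVK.
Qed.

End Realization.

(** * A classful subgroup is the whole group *)

Section Classful.
Variables (R : realType) (H : set (PLhomeo R)).
Hypothesis HC : classful H.
Implicit Types (f g h x y : PLhomeo R) (a b c d e k m s t : R).

Let subH : subgroup H. Proof. by case: HC. Qed.

Lemma classful_conj f : exists y, H (y * f * y^-1)%g.
Proof.
have [_ /(_ f)[x Hx]] := HC.
by exists (x^-1)%g; rewrite invgK -mulgA -conjgE.
Qed.

(** The new base point [y c] is uncontrolled, except for [c = 0], which every map fixes; hence the
    start at 0 and the later use of transitivity. *)
Lemma classful_expanding c a : 0 <= c < 1 -> 1 < a ->
  exists y f, [/\ H f, right_germ (y c) a f & expands_above (y c) f].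
Proof.
move=> c01 a1; have [f [fg fx]] := exists_expanding_germ c01 a1.
have [y Hy] := classful_conj f; exists y, (y * f * y^-1)%g.
by split=> //; [exact: right_germJ|exact: expands_aboveJ].
Qed.

(** The expanding map [g] is fixed before [a], so linearizing by its powers gives one [e] for all
    ratios. *)
Lemma classful_dilation0 : exists e, [/\ 0 < e, e < 1,
  exists2 g, H g & expands_above 0 g &
  forall a, 0 < a -> exists2 h, H h & dilation 0 e a h].
Proof.
have r01 : 0 <= (0 : R) < 1 by rewrite lexx ltr01.
have [|y [g []]] := @classful_expanding 0 2 r01; first by lra.
rewrite PLhomeo0 => Hg [e e0 ge] gx.
(* The bound [2^-1] keeps [d] below 1, so that powers of [g^-1] contract it towards 0. *)
pose d := Num.min e 2^-1.
have d0 : 0 < d by rewrite lt_min e0 invr_gt0 ltr0n.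
have d1 : d < 1 by rewrite gt_min invf_lt1// ltr1n orbT.
exists d; split=> //; first by exists g.
move=> a a0; have [f fa] := exists_right_germ r01 a0.
have [z Hz] := classful_conj f.
have [] := right_germJ z r01 fa; rewrite PLhomeo0 => e' e'0 za.
have [||n Hn] := dilation_linearize a0 _ d0 d1 e'0 (dilation_sub _ ge) gx za.
- by lra.
- by rewrite ge_min lexx.
exists (g ^+ n * (z * f * z^-1) * (g ^+ n)^-1)%g => //.
by apply: subgroupJ => //; exact: subgroupX.
Qed.

(** Negative powers of [g] bring both points into (0, e), where a dilation of ratio [t' / s']
    matches them. *)
Lemma classful_transitive s t : 0 < s < 1 -> 0 < t < 1 -> exists2 h, H h & h s = t.
Proof.
have [e [e0 e1 [g Hg gx] dil]] := classful_dilation0.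
move=> /andP[s0 s1] /andP[t0 t1].
have [n ns] := expands_above_contract gx s1 e0.
have [k kt] := expands_above_contract gx t1 e0.
set s' := (_ s) in ns; set t' := (_ t) in kt.
have s'0 : 0 < s' by rewrite PLhomeo_gt0.
have t'0 : 0 < t' by rewrite PLhomeo_gt0.
have [h Hh [_ h2]] := dil (t' / s') (divr_gt0 t'0 s'0).
have hs : h s' = t'.
  by rewrite h2 ?subr0 ?add0r ?divfK ?gt_eqF// ltW.
exists (g ^+ k * h * (g ^+ n)^-1)%g; last by rewrite !PLhomeoME -/s' hs PLhomeoVK.
by apply: subgroupM => //;
  [apply: subgroupM => //|apply: subgroupV => //]; exact: subgroupX.
Qed.

(** The germ is made at the arbitrary point [2^-1]; transitivity carries its unknown image [y 2^-1]
    to [c]. *)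
Lemma classful_right_germ c a : 0 < c < 1 -> 0 < a ->
  exists2 h, H h & right_germ c a h.
Proof.
move=> c01 a0; have r01 : 0 <= (2^-1 : R) < 1 by lra.
have [f fa] := exists_right_germ r01 a0.
have [y Hy] := classful_conj f.
have [|z Hz zc] := @classful_transitive (y 2^-1) c _ c01.
  by rewrite PLhomeo_gt0 PLhomeo_lt1; lra.
exists (z * (y * f * y^-1) * z^-1)%g.
  exact: subgroupJ.
rewrite -zc; apply: right_germJ; last exact: right_germJ.
by rewrite ltW ?PLhomeo_gt0 ?PLhomeo_lt1; lra.
Qed.

Lemma classful_expanding_at c a : 0 < c < 1 -> 1 < a ->
  exists f, [/\ H f, right_germ c a f & expands_above c f].
Proof.
move=> c01 a1; have r01 : 0 <= (2^-1 : R) < 1 by lra.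
have [y [f [Hf fa fx]]] := classful_expanding r01 a1.
have [|z Hz zc] := @classful_transitive (y 2^-1) c _ c01.
  by rewrite PLhomeo_gt0 PLhomeo_lt1; lra.
exists (z * f * z^-1)%g; rewrite -zc; split.
- exact: subgroupJ.
- by apply: right_germJ => //; rewrite ltW ?PLhomeo_gt0 ?PLhomeo_lt1; lra.
- exact: expands_aboveJ.
Qed.

(* Dilations at [c] valid up to [d] are carried to nearby base points by the
   dilations at 0. *)
Lemma classful_dilation : exists c d, [/\ 0 < c, c < d, d < 1,
  exists2 f, H f & expands_above c f &
  forall c' a, c <= c' -> c' <= d -> 0 < a -> exists2 h, H h & dilation c' d a h].
Proof.
have [e [e0 e1 _ dil0]] := classful_dilation0.
pose c := e / 2; have c0 : 0 < c by rewrite divr_gt0.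
have ce : c < e by rewrite /c; lra.
have c01 : 0 < c < 1 by rewrite c0 (lt_trans ce).
have [|f [Hf [u cu fu] fx]] := @classful_expanding_at c 2 c01; first by lra.
pose d := Num.min e u.
have cd : c < d by rewrite lt_min ce cu.
have de : d <= e by rewrite ge_min lexx.
have d1 : d < 1 by exact: le_lt_trans e1.
exists c, d; split=> //; first by exists f.
move=> c' a cc' c'd a0; have [h Hh [e' ce' ha]] := classful_right_germ c01 a0.
have [||n [k1 k2]] := dilation_linearize a0 _ cd d1 ce' (dilation_sub _ fu) fx ha.
- by lra.
- by rewrite ge_min lexx orbT.
set k := (_ * _)%g in k1 k2.
have Hk : H k.
  by apply: subgroupJ => //; exact: subgroupX.
clearbody k.
(* The dilation [s] of ratio [l] at 0 will take [c] to [c']; as [l >= 1], its inverse maps [0, d]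
   into itself, so [k] is evaluated where it is known. *)
pose l := c' / c; have lc : l * c = c' by rewrite divfK// gt_eqF.
have l1 : 1 <= l by rewrite ler_pdivlMr// mul1r.
have l0 : 0 < l by lra.
have [s Hs sl] := dil0 l l0.
have [s1 s2] := sl; have [r1 r2] := dilationV l0 sl.
have [v vl] : exists v, v * l = 1 by exists l^-1; rewrite mulVf// gt_eqF.
have lVE : l^-1 = v by rewrite -[v]mulr1 -(mulfV (lt0r_neq0 l0)) mulrA vl mul1r.
have v0 : 0 < v by rewrite -lVE invr_gt0.
have v1 : v <= 1 by rewrite -lVE invf_le1.
have vc : v * c' = c by rewrite -lc mulrA vl mul1r.
exists (s * k * s^-1)%g.
  exact: subgroupJ.
have rE t : 0 <= t -> t <= d -> (s^-1)%g t = v * t.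
  by move=> t0 td; rewrite r2 ?lVE ?subr0 ?add0r; nra.
have sE t : 0 <= t -> t <= d -> s (v * t) = t.
  by move=> t0 td; rewrite -rE// PLhomeoVK.
split=> t.
  move=> tc; rewrite !PLhomeoME; have [t0|t0] := leP t 0.
    by rewrite r1// k1 ?s1//; lra.
  by rewrite rE ?k1 ?sE//; nra.
move=> ct td vd; rewrite !PLhomeoME.
have E : c + a * (v * t - c) = v * (c' + a * (t - c')) by rewrite -vc; ring.
have p0 : 0 <= a * (t - c') by rewrite mulr_ge0 ?subr_ge0// ltW.
rewrite rE ?k2 ?E ?sE//; nra.
Qed.

Lemma classful_realize x b : b < 1 ->
  exists2 h, H h & forall t, t <= b -> h t = x t.
Proof.
move=> b1; have [c [d [c0 cd d1 [f Hf fx] dil]]] := classful_dilation.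
have [e0 [p0 e01 dil0]] : exists e, [/\ 0 < e, e < 1 & exists2 h, H h &
    forall t, t <= e -> h t = x t].
  have [e [p0 e1 [m m0 xm]]] := @affine_right R x 0 (introT andP (conj (lexx _) ltr01)).
  have [u [u0 u1 _ /(_ m m0)[h Hh [h1 h2]]]] := classful_dilation0.
  (* The bound [u / m] keeps the image [m * t] within the range of the dilation [h]. *)
  pose v := Num.min (Num.min e u) (u / m).
  have ve : v <= e by rewrite !ge_min lexx.
  have vu : v <= u by rewrite !ge_min lexx orbT.
  have vm : m * v <= u by rewrite mulrC -ler_pdivlMr// ge_min lexx orbT.
  have v0 : 0 < v by rewrite !lt_min p0 u0 divr_gt0.
  exists v; split=> //; [exact: le_lt_trans u1|exists h => // t tv].
  have [t0|t0] := ltP t 0.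
    by rewrite h1 ?(ltW t0)// PLhomeo_out//; lra.
  rewrite h2//; [|exact: le_trans vu|rewrite subr0 add0r; nra].
  by rewrite xm ?PLhomeo0//; exact: le_trans ve.
have [h0 Hh0 hx] := dil0.
(* [h0^-1 * x] is the identity up to [e0]; conjugating by [y] in [H] moves this point to [c]. *)
have [||y Hy yc] := @classful_transitive e0 c; [by rewrite p0 e01|lra|].
pose x1 := (y * (h0^-1 * x) * y^-1)%g.
have x1E t : t <= c -> x1 t = t.
  rewrite -(PLhomeoVK y t) /x1 -yc PLhomeo_le; move: (_ t) => s se.
  by rewrite !PLhomeoME PLhomeoK -hx// PLhomeoK.
pose b1' := Num.max (y b) c.
have b1'1 : b1' < 1 by rewrite gt_max PLhomeo_lt1 b1/=; lra.
(* Argument and value must both be contracted below [d]; the maximum with [c] in [b1'] ensures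
   [c <= e] below. *)
pose q := Num.max b1' (x1 b1').
have q1 : q < 1 by rewrite gt_max PLhomeo_lt1 b1'1.
have [n nq] := expands_above_contract fx q1 cd.
pose F := (f ^+ n)%g; pose e := (F^-1)%g b1'.
have HF : H F by exact: subgroupX.
have Fc t : t <= c -> F t = t.
  move=> tc; rewrite /F; elim: (n) => [|k IH]; first by rewrite expg0.
  by rewrite expgS PLhomeoME IH; exact: fx.1.
have FVc t : t <= c -> (F^-1)%g t = t by move=> tc; rewrite -{1}(Fc t tc) PLhomeoK.
pose x2 := (F^-1 * x1 * F)%g.
have ce : c <= e by rewrite -(FVc c (lexx c)) PLhomeo_le le_max lexx orbT.
have e1 : e < 1 by rewrite PLhomeo_lt1.
have [k Hk] := PLhomeo_affine_pieces x2 (ltW c0) ce (ltW e1).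
have [|||h Hh hx2] := realize_pieces subH dil (lexx c) _ _ _ Hk.
- by apply: le_trans (ltW nq); rewrite PLhomeo_le le_max lexx.
- apply: le_trans (ltW nq); rewrite /x2 PLhomeoME PLhomeoME PLhomeoVK PLhomeo_le.
  by rewrite le_max lexx orbT.
- by move=> t tc; rewrite /x2 PLhomeoME PLhomeoME Fc// x1E// FVc.
have Hy' := subgroupV subH Hy; have HF' := subgroupV subH HF.
exists (h0 * (y^-1 * (F * h * F^-1) * y))%g.
  by do !apply: subgroupM => //.
move=> t tb; rewrite !PLhomeoME hx2; last first.
  by rewrite PLhomeo_le le_max PLhomeo_le tb.
by rewrite /x2 /x1 !PLhomeoME !(PLhomeoVK, PLhomeoK).
Qed.

Lemma classful_id_near1 (u : PLhomeo R) b :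
  b < 1 -> (forall t, b <= t -> u t = t) -> H u.
Proof.
move=> b1 ub; have [y Hy] := classful_conj u.
have [h Hh hy] := classful_realize y b1.
have -> : u = (h^-1 * (y * u * y^-1) * h)%g; last first.
  by apply: subgroupM => //; apply: subgroupM => //; exact: subgroupV.
apply: PLhomeo_eq => t; apply: (can_inj (PLhomeoK h)).
rewrite !PLhomeoME PLhomeoVK.
(* Left of [b], [u] preserves the region where [h] and [y] agree; right of [b], [h t >= y b], so
   [y^-1] brings [h t] to a point fixed by [u]. *)
have [tb|bt] := leP t b.
  rewrite (hy t)// PLhomeoK -hy// -(ub b (lexx b)) PLhomeo_le//.
have hbt : y b <= h t by rewrite -hy// PLhomeo_le ltW.
by rewrite (ub t (ltW bt)) ub ?PLhomeoVK// -(PLhomeo_le y) PLhomeoVK.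
Qed.

Lemma classfulT : H = setT.
Proof.
apply/seteqP; split=> // x _; have [y Hy] := classful_conj x.
set z := (y * x * y^-1)%g in Hy.
suff Hxz : H (x * z^-1)%g by rewrite -(mulgVK z x); apply: subgroupM.
have near1 f : exists e m, [/\ e < 1, 0 < m &
    forall t, e <= t -> t <= 1 -> f t = 1 - m * (1 - t)].
  have [e [e0 e1 [m m0 fm]]] := affine_left1 f; exists e, m; split=> // t et t1.
  by have := fm 1 (ltW e1) (lexx 1); rewrite PLhomeo1 (fm t)//; lra.
have [e [m [e1 m0 xm]]] := near1 x; have [u [k [u1 k0 yk]]] := near1 y.
pose v := Num.max e u.
have ev : e <= v by rewrite le_max lexx.
have uv : u <= v by rewrite le_max lexx orbT.
have v1 : v < 1 by rewrite gt_max e1.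
(* Beyond [w] both [s] and [x s] are at least [v]; beyond [b] both [t >= v] and [y^-1 t >= w]. Thus
   [x] and [y] are only evaluated on their last affine pieces. *)
pose w := Num.max v ((x^-1)%g v).
have w1 : w < 1 by rewrite gt_max PLhomeo_lt1 v1.
pose b := Num.max v (y w).
have b1 : b < 1 by rewrite gt_max PLhomeo_lt1 v1.
(* With the argument written as [z t], the claim becomes [x t = z t] for [t >= b]. *)
apply: (@classful_id_near1 _ (z b)); first by rewrite PLhomeo_lt1.
move=> t; rewrite -(PLhomeoVK z t) PLhomeo_le PLhomeoME PLhomeoK.
move: (_ t) => {}t bt; have [t1|t1] := ltP 1 t.
  by rewrite !PLhomeo_out//; lra.
have vt : v <= t by rewrite (le_trans _ bt)// le_max lexx.
have wt : w <= (y^-1)%g t.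
  by rewrite -(PLhomeo_le y) PLhomeoVK (le_trans _ bt)// le_max lexx orbT.
rewrite xm//; last exact: le_trans vt.
rewrite /z !PLhomeoME -{1}(PLhomeoVK y t); move: (_ t) wt (PLhomeoVK y t) => s ws ys.
have s1 : s <= 1 by rewrite -(PLhomeo_le y) ys PLhomeo1.
have vs : v <= s by rewrite (le_trans _ ws)// le_max lexx.
have vxs : v <= x s.
  by rewrite -[v](PLhomeoVK x) PLhomeo_le (le_trans _ ws)// le_max lexx orbT.
rewrite (yk (x s)); [|exact: le_trans vxs|by rewrite -(PLhomeo1 x) PLhomeo_le].
rewrite (yk s)//; last exact: le_trans vs.
(* As [t = y s], both sides equal [1 - k * m * (1 - s)]. *)
by rewrite (xm s)//; [ring|exact: le_trans vs].
Qed.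

End Classful.

Theorem theorem3 (R : realType) : invariably_generated (PLhomeo R).
Proof. by move=> H HC; exact: classfulT. Qed.
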